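(* Let $p$ and $q$ be prime numbers with $p<q$ and $p \equiv q \equiv 3 \pmod 4$. Then $$\kappa(4pq) \equiv 1 + \left(\frac{q}{p}\right) \pmod 4,$$ where $\left(\frac{q}{p}\right)$ is the Legendre symbol.
   Context: A real quadratic number is a real irrational root $w$ of a quadratic polynomial with integer coefficients; $w'$ denotes its algebraic conjugate over $\mathbb{Q}$. The discriminant $\mathrm{disc}(w)$ of $w$ is $b^2-4ac$, where $aw^2+bw+c=0$ with $a,b,c\in\mathbb{Z}$, $a>0$, $\gcd(a,b,c)=1$. A real quadratic number $w$ is reduced if $w>1$ and $-1<w'<0$. For a positive non-square integer $D$, $\kappa(D)$ denotes the (finite) number of reduced real quadratic numbers $w$ with $\mathrm{disc}(w)=D$. *)

(* Defs.v *)
From mathcomp Require Import all_boot all_order all_algebra finmap.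
From mathcomp Require Import boolp classical_sets functions cardinality reals.

Set Implicit Arguments.
Unset Strict Implicit.
Unset Printing Implicit Defensive.

Import Order.TTheory GRing.Theory Num.Theory.

Local Open Scope classical_set_scope.
Local Open Scope fset_scope.
Local Open Scope ring_scope.

Definition real_quadratic (R : realType) (w : R) : Prop :=
  irrational w /\
  exists p : {poly int}, size p = 3%N /\ root (map_poly intr p) w.

(* The triple (a, b, c), hence the discriminant, is uniquely determined when w
   is a real quadratic number. *)
Definition has_disc (R : realType) (w : R) (D : int) : Prop :=
  exists a b c : int,
    [/\ 0 < a, gcdz (gcdz a b) c = 1,
        a%:~R * w ^+ 2 + b%:~R * w + c%:~R = 0
      & D = b ^+ 2 - 4 * a * c].

(* w' is a root, other than w, of a minimal polynomial of w over Q; for a real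
   quadratic number w there is exactly one such w'. *)
Definition is_conjugate (R : realType) (w w' : R) : Prop :=
  w' != w /\
  exists p : {poly rat},
    [/\ irreducible_poly p, root (map_poly ratr p) w
      & root (map_poly ratr p) w'].

Definition reduced (R : realType) (w : R) : Prop :=
  1 < w /\ exists w' : R, is_conjugate w w' /\ -1 < w' < 0.

Definition reduced_quadratic (R : realType) (D : nat) : set R :=
  [set w | [/\ real_quadratic w, reduced w & has_disc w D%:Z]].

(* [fset_set] returns the empty set on infinite sets, but for non-square D > 0
   the set of reduced quadratic numbers of discriminant D is finite. *)
Definition kappa (R : realType) (D : nat) : nat :=
  #|` fset_set (@reduced_quadratic R D)|.

(* Meaningful for p an odd prime. *)
Definition legendre (a : int) (p : nat) : int :=
  if (p %| a)%Z then 0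
  else if [exists x : 'I_p, ((x%:Z ^+ 2)%R == a %[mod p])%Z] then 1
  else -1.

(* Main.v *)
(* The reduced numbers of discriminant 4N, N = pq, are (k + sqrt N) / a for the
   triples (a, k, c) with k^2 + ac = N, |a - c| < 2k and gcd (a, 2k, c) = 1.
   The genus character at p splits these triples into two classes, which the
   involution w |-> -1 / w', i.e. (a, k, c) |-> (c, k, a), exchanges because
   -1 is a non-residue mod p; so kappa is twice the size of one class. The
   involution w |-> floor w - w' keeps a and preserves each class. It
   has exactly two fixed points, with a = 1 and a = p: the former lies in the
   class of character 1, the latter lies there iff (q / p) = -1. *)
Require Import Defs.
From mathcomp Require Import all_boot all_order all_algebra finmap.
From mathcomp Require Import classical_sets cardinality reals.
From mathcomp Require Import zify lra.

Import Order.TTheory GRing.Theory Num.Theory.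

Local Open Scope ring_scope.

Set Implicit Arguments.
Unset Strict Implicit.
Unset Printing Implicit Defensive.

Lemma in_sepfset (T : choiceType) (A : {fset T}) (P : pred T) (x : T) :
  (x \in [fset y in A | P y]%fset) = (x \in A) && P x.
Proof. by rewrite !inE. Qed.

(** Points that are not fixed pair off as x, f x; the induction removes one such pair at a time. *)
Lemma odd_card_involution (T : choiceType) (f : T -> T) (A : {fset T}) :
  {in A, forall x, f x \in A} -> {in A, forall x, f (f x) = x} ->
  odd #|` A| = odd #|` [fset x in A | f x == x]%fset|.
Proof.
elim: {A}_.+1 {-2}A (ltnSn #|` A|) => // n IHn A leAn fA fK.
have [/existsP[/= [x xA] /= fx_x]|/existsPn /= fix_all] :=
  boolP [exists x : A, f (val x) != val x]; last first.
  congr (odd #|` _|); apply/fsetP => x; rewrite !inE /=.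
  case: (boolP (x \in A)) => //= xA.
  by have := fix_all [` xA]%fset; rewrite negbK.
have fxA := fA _ xA.
have cA : #|` A| = #|` A `\ x `\ f x|%fset.+2.
  by rewrite (cardfsD1 x A) xA (cardfsD1 (f x) (A `\ x)%fset) !inE fx_x fxA.
rewrite cA /= negbK IHn; first last.
- by move=> y; rewrite !inE => /and3P[_ _ /fK].
- move=> y; rewrite !inE => /and3P[y_fx y_x yA]; rewrite fA // andbT.
  apply/andP; split.
    by apply: contraNneq y_x => fy; rewrite -(fK y) // fy fK.
  by apply: contraNneq y_fx => fy; rewrite -(fK y) // fy.
- by move: leAn; rewrite cA; lia.
congr (odd #|` _|); apply/fsetP => y; rewrite !inE /=.
case: (boolP (y \in A)) => yA; rewrite ?andbF //= ?andbT.
apply/andP/idP => [[]//|fy]; split=> //; apply/andP; split.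
  by apply: contraTneq fy => ->; rewrite fK // eq_sym.
by apply: contraTneq fy => ->.
Qed.

(** * Reduced forms, their swap and their flip *)

(* (a, k, c) stands for the number (k + sqrt N) / a, a root of
   a X^2 - 2 k X - c; the two inequalities say that this polynomial is negative
   at 1 and positive at -1. *)
Definition reduced_form (N : nat) (f : nat * nat * nat) : bool :=
  let: (a, k, c) := f in
  [&& (0 < a)%N, (0 < c)%N, (k ^ 2 + a * c == N)%N, (a < c + 2 * k)%N,
      (c < a + 2 * k)%N & gcdn (gcdn a (2 * k)) c == 1]%N.

Definition reduced_forms (N : nat) : {fset nat * nat * nat} :=
  [fset f in [seq (ak, c) | ak <- [seq (a, k) | a <- iota 0 N.+1,
                k <- iota 0 N.+1], c <- iota 0 N.+1] | reduced_form N f]%fset.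

Lemma mem_reduced_forms (N : nat) (f : nat * nat * nat) :
  (f \in reduced_forms N) = reduced_form N f.
Proof.
rewrite in_fset inE.
case: (boolP (reduced_form N f)) => Nf; rewrite ?andbF // andbT.
case: f Nf => [[a k] c] /and5P[a0 c0 /eqP eqN _ _].
(* [a] and [c] are at most [a * c], and [k] is at most [k ^ 2], so no entry exceeds [N]. *)
by apply: allpairs_f; [apply: allpairs_f|]; rewrite mem_iota add0n ltnS; nia.
Qed.

Lemma gcd3_eq1P (a b c : nat) :
  reflect (forall d, d %| a -> d %| b -> d %| c -> d = 1)%N
          (gcdn (gcdn a b) c == 1)%N.
Proof.
apply: (iffP eqP) => [g1 d da db dc|g1].
  by apply/eqP; rewrite -dvdn1 -g1 !dvdn_gcd da db dc.
apply: g1; last exact: dvdn_gcdr.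
  exact: dvdn_trans (dvdn_gcdl _ _) (dvdn_gcdl _ _).
exact: dvdn_trans (dvdn_gcdl _ _) (dvdn_gcdr _ _).
Qed.

Definition swap_form (f : nat * nat * nat) : nat * nat * nat :=
  let: (a, k, c) := f in (c, k, a).

Lemma swap_formK : involutive swap_form.
Proof. by case=> [[a k] c]. Qed.

Lemma reduced_swap (N : nat) (f : nat * nat * nat) :
  reduced_form N f -> reduced_form N (swap_form f).
Proof.
case: f => [[a k] c] /and5P[a0 c0 /eqP eqN ac /andP[ca g1]].
apply/and5P; split=> //; first by rewrite mulnC eqN.
rewrite ac /=; apply/gcd3_eq1P => d dc dk da.
by move/gcd3_eq1P: g1; apply.
Qed.

(* w |-> floor w - w', for w = (k + sqrt N) / a and s = floor (sqrt N). *)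
Definition flip_form (N s : nat) (f : nat * nat * nat) : nat * nat * nat :=
  let: (a, k, _) := f in
  let k' := (s - (k + s) %% a)%N in (a, k', (N - k' ^ 2) %/ a)%N.

(** This is the substitution X -> m - X in a X^2 - 2 k X - c, written with additions only so that no
    subtraction truncates. *)
Lemma flip_shift (a k c k' c' m : nat) : (0 < a)%N -> (k + k' = m * a)%N ->
  (k' ^ 2 + a * c' = k ^ 2 + a * c)%N ->
  (c' + m * m * a = c + m * (2 * k))%N.
Proof.
move=> a0 kk' eqN; apply/eqP; rewrite -(eqn_pmul2l a0); apply/eqP.
have -> : (a * (c' + m * m * a) = a * c' + (m * a) * (m * a))%N by lia.
have -> : (a * (c + m * (2 * k)) = a * c + (m * a) * (2 * k))%N by lia.
by rewrite -kk'; lia.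
Qed.

Section Flip.

Variables N s : nat.
Hypothesis s_lo : (s ^ 2 < N)%N.
Hypothesis s_hi : (N < s.+1 ^ 2)%N.

(** Multiplied by a, the inequalities read (a - k)^2 < N < (a + k)^2, which s turns into linear
    bounds. For given a they confine k to the window (s - a, s] of length a. *)
Lemma reduced_ineqE (a k c : nat) :
  (0 < a)%N -> (0 < c)%N -> (k ^ 2 + a * c = N)%N ->
  (a < c + 2 * k)%N && (c < a + 2 * k)%N =
  [&& k <= s, a <= k + s & s < a + k]%N.
Proof.
move=> a0 c0 eqN.
have -> : (k <= s)%N by nia.
have -> : (c < a + 2 * k)%N = (s < a + k)%N.
  by apply/idP/idP => H; nia.
rewrite /=; case: (ltnP s (a + k)) => sak; rewrite ?andbF // !andbT.
apply/idP/idP => H; last first.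
  case: (leqP a k) => ak; first by nia.
  by have [d ad] : exists d, a = (k + d)%N; [exists (a - k)%N; lia|nia].
rewrite leqNgt; apply/negP => ksa.
by have [d ad] : exists d, a = (k + s + d.+1)%N;
  [exists (a - k - s).-1; lia|nia].
Qed.

(** Here m is the integer part of w, and k' represents -k modulo a in the window (s - a, s]. *)
Lemma flip_formP (a k c : nat) : reduced_form N (a, k, c) ->
  exists k' c' m, [/\ flip_form N s (a, k, c) = (a, k', c'), (k + k' = m * a)%N,
    (k' ^ 2 + a * c' = N)%N, (0 < m)%N & (k' <= s < a + k')%N].
Proof.
case/and5P=> a0 c0 /eqP eqN ac /andP[ca _].
have := reduced_ineqE a0 c0 eqN; rewrite ac ca => /esym/and3P[ks aks sak].
rewrite /flip_form; set r := ((k + s) %% a)%N.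
have ra : (r < a)%N by rewrite ltn_mod.
have eqm := divn_eq (k + s) a; rewrite -/r in eqm.
set m := ((k + s) %/ a)%N in eqm.
have m0 : (0 < m)%N by rewrite divn_gt0.
have rs : (r <= s)%N by nia.
have kk' : (k + (s - r) = m * a)%N by lia.
exists (s - r)%N, ((N - (s - r) ^ 2) %/ a)%N, m; split=> //; last by lia.
have k's : ((s - r) ^ 2 < N)%N.
  by apply: leq_ltn_trans s_lo; rewrite leq_sqr leq_subr.
rewrite mulnC divnK; first by rewrite subnKC // ltnW.
move: kk' k's; move: (s - r)%N => k' kk' k's.
have -> : (N - k' ^ 2 = (c + 2 * m * k - m * m * a) * a)%N by nia.
exact: dvdn_mull.
Qed.

Lemma reduced_flip (f : nat * nat * nat) :
  reduced_form N f -> reduced_form N (flip_form N s f).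
Proof.
case: f => [[a k] c] Nf.
have [k' [c' [m [-> kk' eqN' m0 /andP[k's sak']]]]] := flip_formP Nf.
case/and5P: Nf => a0 c0 /eqP eqN ac /andP[ca /gcd3_eq1P g1].
have := reduced_ineqE a0 c0 eqN; rewrite ac ca => /esym/and3P[ks aks sak].
have c'0 : (0 < c')%N by nia.
have cc' := flip_shift a0 kk' (etrans eqN' (esym eqN)).
rewrite /reduced_form a0 c'0 eqN' eqxx /= andbA reduced_ineqE // k's sak' andbT.
(* As m >= 1 and k <= s, k' = m a - k is at least a - s. *)
apply/andP; split; first by nia.
apply/gcd3_eq1P => d da dk' dc'.
have dk : (d %| 2 * k)%N.
  by rewrite -(dvdn_addl _ dk') -mulnDr kk' !dvdn_mull.
apply: g1 => //.
by rewrite -(dvdn_addl _ (dvdn_mull m dk)) -cc' dvdn_add // dvdn_mull.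
Qed.

Lemma flip_formK (f : nat * nat * nat) :
  reduced_form N f -> flip_form N s (flip_form N s f) = f.
Proof.
case: f => [[a k] c] Nf; have := reduced_flip Nf.
have [k' [c' [m [-> kk' eqN' m0 /andP[k's sak']]]]] := flip_formP Nf.
move/flip_formP => [k2 [c2 [m2 [-> kk2 eqN2 m20 /andP[k2s sak2]]]]].
case/and5P: Nf => a0 c0 /eqP eqN ac /andP[ca _].
have := reduced_ineqE a0 c0 eqN; rewrite ac ca => /esym/and3P[ks aks sak].
(* Both k and k2 are -k' modulo a and lie in the window (s - a, s]. *)
have k2k : k2 = k.
  case: (ltngtP m2 m) => mm; last by lia.
    by have := leq_mul mm (leqnn a); rewrite mulSn; lia.
  by have := leq_mul mm (leqnn a); rewrite mulSn; lia.
by rewrite k2k in eqN2 *; congr (_, _); apply/eqP; rewrite -(eqn_pmul2l a0); lia.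
Qed.

End Flip.

(** * The quadratic character modulo p *)

(** For odd p, the Legendre symbol in Euler's form n^((p-1)/2), valued in ['F_p], where
    multiplicativity is immediate. *)
Definition quad_char (p n : nat) : 'F_p := n%:R ^+ p./2.

Section QuadChar.

Variable p : nat.
Hypothesis p_pr : prime p.
Hypothesis p3 : (p %% 4 = 3)%N.

Lemma natr_Fp_eq0 (n : nat) : (n%:R == 0 :> 'F_p) = (p %| n)%N.
Proof. by rewrite (dvdn_pcharf (pchar_Fp p_pr)). Qed.

Lemma natr_Fp_eq (m n : nat) : (m%:R == n%:R :> 'F_p) = (m == n %[mod p])%N.
Proof. by rewrite -val_eqE /= !val_Fp_nat. Qed.

Lemma oner_neqN1_Fp : (1 == -1 :> 'F_p) = false.
Proof.
rewrite -subr_eq0 opprK -[1 + 1]/(2%:R) natr_Fp_eq0.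
by apply/negP => /dvdn_leq -/(_ isT); lia.
Qed.

Lemma quad_charM (m n : nat) :
  quad_char p (m * n) = quad_char p m * quad_char p n.
Proof. by rewrite /quad_char natrM exprMn. Qed.

Lemma quad_char1 : quad_char p 1 = 1.
Proof. exact: expr1n. Qed.

Lemma quad_char_eq_mod (m n : nat) :
  m = n %[mod p] -> quad_char p m = quad_char p n.
Proof. by move=> /eqP; rewrite -natr_Fp_eq /quad_char => /eqP->. Qed.

Lemma quad_char_dvd (n : nat) : (p %| n)%N -> quad_char p n = 0.
Proof.
rewrite -natr_Fp_eq0 /quad_char => /eqP->.
(* The exponent is nonzero; otherwise the power would be 1. *)
by rewrite expr0n; case: eqP => //; lia.
Qed.

Lemma sqr_quad_char (n : nat) : ~~ (p %| n)%N -> quad_char p n ^+ 2 = 1.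
Proof.
rewrite -natr_Fp_eq0 => n0; rewrite /quad_char -exprM.
(* Multiplied by n, the claim becomes Fermat's little theorem. *)
apply: (mulfI n0); rewrite -exprS mulr1 -natrX.
have -> : ((p./2 * 2).+1 = p)%N by lia.
by apply/eqP; rewrite natr_Fp_eq fermat_little.
Qed.

Lemma quad_char_pm1 (n : nat) : ~~ (p %| n)%N ->
  quad_char p n = 1 \/ quad_char p n = -1.
Proof.
by move=> /sqr_quad_char /eqP; rewrite sqrf_eq1 => /orP[]/eqP; [left|right].
Qed.

(* [p./2] is odd because p = 3 mod 4, so that -1 is a non-residue. *)
Lemma quad_charN (m n : nat) : (p %| m + n)%N ->
  quad_char p m = - quad_char p n.
Proof.
rewrite -natr_Fp_eq0 natrD addr_eq0 /quad_char => /eqP->.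
rewrite exprNn -signr_odd; have -> : odd p./2 by lia.
by rewrite mulN1r.
Qed.

Lemma legendreE (n : nat) : ~~ (p %| n)%N ->
  legendre n%:Z p = if quad_char p n == 1 then 1 else -1.
Proof.
move=> pn; rewrite /legendre dvdzE /= (negbTE pn); congr (if _ then _ else _).
have sqrz x : x%:Z ^+ 2 = (x ^ 2)%N by rewrite -mulnn PoszM.
apply/existsP/eqP => [[x]|n1].
  rewrite sqrz !modz_nat eqz_nat => /eqP xn.
  rewrite -(quad_char_eq_mod xn) -mulnn quad_charM -expr2.
  rewrite sqr_quad_char //; apply: contra pn => px.
  have := dvdn_exp (isT : 0 < 2)%N px; rewrite /dvdn xn //.
(* A residue n has the explicit square root n ^ ((p + 1) / 4). *)
have p0 : (0 < p)%N by apply: prime_gt0.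
exists (Ordinal (ltn_pmod (n ^ (p.+1 %/ 4)) p0)).
rewrite sqrz /= !modz_nat eqz_nat modnXm -expnM.
rewrite -natr_Fp_eq natrX; have -> : (p.+1 %/ 4 * 2 = p./2.+1)%N by lia.
by rewrite exprS -/(quad_char p n) n1 mulr1.
Qed.

End QuadChar.

(** * Genus classes and the count modulo 4 *)

Section Count.

Variables p q : nat.
Hypotheses (p_pr : prime p) (q_pr : prime q) (pq : (p < q)%N).
Hypotheses (p3 : (p %% 4 = 3)%N) (q3 : (q %% 4 = 3)%N).

Let N := (p * q)%N.

Let N_mod4 : (N %% 4 = 1)%N.
Proof. by rewrite /N -modnMm p3 q3. Qed.

(* The genus character at p of the binary form a x^2 - 2 k x y - c y^2,
   which represents both a and -c. *)
Definition plus_form (f : nat * nat * nat) : bool :=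
  let: (a, _, c) := f in (quad_char p a == 1) || (quad_char p c == -1).

Lemma dvd_p_mid (a k c : nat) :
  reduced_form N (a, k, c) -> (p %| a * c)%N -> (p %| k)%N.
Proof.
case/and5P=> _ _ /eqP eqN _ _ pac.
have : (p %| k ^ 2 + a * c)%N by rewrite eqN dvdn_mulr.
by rewrite dvdn_addl // Euclid_dvdX // andbT.
Qed.

Lemma dvd_p_outer (a k c : nat) :
  reduced_form N (a, k, c) -> (p %| a)%N -> ~~ (p %| c)%N.
Proof.
move=> Nf pa; apply/negP => pc.
have pk : (p %| k)%N by apply: dvd_p_mid Nf _; rewrite dvdn_mulr.
case/and5P: Nf => _ _ _ _ /andP[_ /gcd3_eq1P/(_ p pa _ pc) p1].
by move: p_pr; rewrite p1 // dvdn_mull.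
Qed.

(** If p divides neither a nor c, then a c = -k^2 modulo p, so a and c have opposite characters. If
    p divides one of them, the other is prime to p and alone decides. *)
Lemma plus_form_swap (f : nat * nat * nat) :
  reduced_form N f -> plus_form (swap_form f) = ~~ plus_form f.
Proof.
case: f => [[a k] c] Nf; rewrite /plus_form /=.
have sgn : (0 == 1 :> 'F_p = false) * (0 == -1 :> 'F_p = false)
    * (-1 == 1 :> 'F_p = false) * (1 == -1 :> 'F_p = false).
  by rewrite eq_sym oner_eq0 eq_sym oppr_eq0 oner_eq0 eq_sym oner_neqN1_Fp.
have [pa|pa] := boolP (p %| a)%N.
  have pc := dvd_p_outer Nf pa; rewrite (quad_char_dvd p_pr p3 pa).
  by have [->|->] := quad_char_pm1 p_pr p3 pc; rewrite !sgn !eqxx.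
have [pc|pc] := boolP (p %| c)%N.
  rewrite (quad_char_dvd p_pr p3 pc).
  by have [->|->] := quad_char_pm1 p_pr p3 pa; rewrite !sgn !eqxx.
have pk : ~~ (p %| k)%N.
  case/and5P: Nf => _ _ /eqP eqN _ _; apply/negP => pk.
  have : (p %| k ^ 2 + a * c)%N by rewrite eqN dvdn_mulr.
  rewrite dvdn_addr; last exact: dvdn_exp.
  by rewrite Euclid_dvdM // (negbTE pa) (negbTE pc).
have : quad_char p a * quad_char p c = -1.
  case/and5P: Nf => _ _ /eqP eqN _ _.
  rewrite -quad_charM -(sqr_quad_char p_pr p3 pk) expr2 -quad_charM.
  by apply: (quad_charN p_pr p3); rewrite mulnn addnC eqN dvdn_mulr.
have [->|->] := quad_char_pm1 p_pr p3 pa;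
have [->|->] := quad_char_pm1 p_pr p3 pc;
by rewrite ?mulrNN ?mulr1 => /eqP; rewrite !sgn ?eqxx.
Qed.

(** If a has character -1, the swapped form is a plus form, so [plus_form_swap] excludes the form
    itself. *)
Lemma plus_formE (a k c : nat) : reduced_form N (a, k, c) -> ~~ (p %| a)%N ->
  plus_form (a, k, c) = (quad_char p a == 1).
Proof.
move=> Nf pa; have := plus_form_swap Nf; rewrite /plus_form /=.
have [->|->] := quad_char_pm1 p_pr p3 pa; first by rewrite eqxx.
by rewrite eqxx orbT eq_sym oner_neqN1_Fp // => /esym/negbTE.
Qed.

Variable s : nat.
Hypothesis s_lo : (s ^ 2 < N)%N.
Hypothesis s_hi : (N < s.+1 ^ 2)%N.

(** If p does not divide a, only a matters, and the flip keeps it. Otherwise p divides k too, and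
    [flip_shift] gives c' = c modulo p. *)
Lemma plus_form_flip (f : nat * nat * nat) :
  reduced_form N f -> plus_form (flip_form N s f) = plus_form f.
Proof.
case: f => [[a k] c] Nf; have := reduced_flip s_lo s_hi Nf.
have [k' [c' [m [-> kk' eqN' m0 _]]]] := flip_formP s_lo s_hi Nf => Nf'.
have [pa|pa] := boolP (p %| a)%N; last by rewrite !plus_formE.
rewrite /plus_form; congr (_ || (_ == _)); apply: quad_char_eq_mod => //.
have pk : (p %| k)%N by apply: dvd_p_mid Nf _; rewrite dvdn_mulr.
case/and5P: Nf => a0 _ /eqP eqN _ _.
have cc' := flip_shift a0 kk' (etrans eqN' (esym eqN)).
have pma : (p %| m * m * a)%N by rewrite dvdn_mull.
have pmk : (p %| m * (2 * k))%N by rewrite !dvdn_mull.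
apply/eqP; rewrite -(eqn_modDr (m * m * a)) cc' eqn_modDl.
by rewrite (eqP pma) (eqP pmk).
Qed.

(** A fixed form has 2 k = m a. An odd a then divides k, hence N; and q cannot divide a, since k >=
    q would give k^2 >= q^2 > N. *)
Lemma flip_fixed (a k c : nat) : reduced_form N (a, k, c) ->
  flip_form N s (a, k, c) = (a, k, c) -> a = 1%N \/ a = p.
Proof.
move=> Nf; have [k' [c' [m [-> kk' _ _ _]]]] := flip_formP s_lo s_hi Nf.
case=> k'k _; rewrite {}k'k in kk'.
case/and5P: Nf => a0 c0 /eqP eqN ac /andP[ca /gcd3_eq1P g1].
have a_dvd : (a %| 2 * k)%N by apply/dvdnP; exists m; lia.
have [a_odd|a_even] := boolP (odd a); last first.
  (* For even a, k is odd, hence a = 2 mod 4 and a * c = N - k ^ 2 = 0 mod 4. *)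
  have [b ab] : exists b, a = (2 * b)%N by exists a./2; lia.
  have k_odd : odd k.
    have := congr1 odd eqN; rewrite oddD oddX oddM (negbTE a_even) addbF /= => ->.
    by move: (N) N_mod4 => M; lia.
  have [e ke] : exists e, k = (2 * e + 1)%N by exists k./2; lia.
  have kmb : k = (m * b)%N by lia.
  have b_odd : odd b by move: k_odd; rewrite kmb oddM => /andP[].
  have [d bd] : exists d, b = (2 * d + 1)%N by exists b./2; lia.
  have c_even : (2 %| c)%N.
    by move: eqN N_mod4; rewrite ke ab bd; move: (N) => M; lia.
  have : 2 = 1%N by apply: g1 => //; rewrite ?ab dvdn_mulr.
  by [].
have ak : (a %| k)%N by rewrite Gauss_dvdr // coprimen2 in a_dvd.
have aN : (a %| p * q)%N by rewrite -/N -eqN dvdn_add // dvdn_mulr.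
have k0 : (0 < k)%N by lia.
have qa : ~~ (q %| a)%N.
  apply/negP => qa; have qk := dvdn_leq k0 (dvdn_trans qa ak).
  have : (p * q < q * q)%N by rewrite ltn_pmul2r ?prime_gt0.
  by have := leq_mul qk qk; rewrite -/N -eqN; lia.
move: aN; rewrite mulnC Gauss_dvdr; last by rewrite coprime_sym prime_coprime.
by move=> /(primeP p_pr).2 /orP[]/eqP; [left|right].
Qed.

(** The only multiple of p in the window (s - p, s], hence the only possible middle entry of a
    reduced form with a = p. *)
Let k_p := (p * (s %/ p))%N.

Let p_le_s : (p <= s)%N.
Proof.
rewrite -ltnS -ltn_sqr; apply: leq_ltn_trans s_hi.
by rewrite -mulnn leq_mul2l ltnW ?orbT.
Qed.

Lemma reduced_form_1 : reduced_form N (1, s, N - s ^ 2)%N.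
Proof.
have c0 : (0 < N - s ^ 2)%N by rewrite subn_gt0.
have eqN : (s ^ 2 + 1 * (N - s ^ 2) = N)%N by rewrite mul1n subnKC // ltnW.
rewrite /reduced_form c0 eqN eqxx /= andbA (reduced_ineqE s_lo s_hi) //.
by rewrite !gcd1n; move: p_le_s (prime_gt0 p_pr); lia.
Qed.

Lemma reduced_form_p : reduced_form N (p, k_p, q - p * (s %/ p) ^ 2)%N.
Proof.
have p0 := prime_gt0 p_pr.
have kps : (k_p <= s)%N by rewrite /k_p mulnC leq_trunc_div.
have skp : (s < p + k_p)%N.
  by rewrite /k_p {1}(divn_eq s p) mulnC addnC ltn_add2r ltn_pmod.
have kN : (k_p ^ 2 < N)%N by apply: leq_ltn_trans s_lo; rewrite leq_sqr.
have kqN : (p * (p * (s %/ p) ^ 2) < p * q)%N by rewrite mulnA mulnn -expnMn.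
have c0 : (0 < q - p * (s %/ p) ^ 2)%N by rewrite subn_gt0 -(ltn_pmul2l p0).
have eqN : (k_p ^ 2 + p * (q - p * (s %/ p) ^ 2) = N)%N.
  by rewrite mulnBr /k_p expnMn -mulnn -mulnA subnKC // ltnW.
rewrite /reduced_form p0 c0 eqN eqxx /= andbA (reduced_ineqE s_lo s_hi) //.
rewrite kps skp (leq_trans p_le_s) ?leq_addl //=.
apply/gcd3_eq1P => d dp _; have /(primeP p_pr).2/orP[/eqP//|/eqP->] := dp.
rewrite dvdn_subl; [|by rewrite ltnW // -subn_gt0|by rewrite dvdn_mulr].
by rewrite dvdn_prime2 // => /eqP; lia.
Qed.

Lemma flip_form_1 : flip_form N s (1, s, N - s ^ 2)%N = (1, s, N - s ^ 2)%N.
Proof. by rewrite /flip_form modn1 subn0 divn1. Qed.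

Lemma flip_form_p : flip_form N s (p, k_p, q - p * (s %/ p) ^ 2)%N =
  (p, k_p, q - p * (s %/ p) ^ 2)%N.
Proof.
have [_ _ /eqP eqN _ _] := and5P reduced_form_p.
have sk : (s - (k_p + s) %% p = k_p)%N.
  by rewrite /k_p mulnC modnMDl {1}(divn_eq s p) addnK.
rewrite /flip_form sk; congr (_, _).
by rewrite -eqN addKn mulKn // prime_gt0.
Qed.


(** The window (s - a, s] holds one representative of each class modulo a, so the class fixes k, and
    then N fixes c. *)
Lemma reduced_form_eq (a k c k' c' : nat) :
  reduced_form N (a, k, c) -> reduced_form N (a, k', c') ->
  k = k' %[mod a] -> (a, k, c) = (a, k', c').
Proof.
case/and5P=> a0 c0 /eqP eqN ac /andP[ca _].
have := reduced_ineqE s_lo s_hi a0 c0 eqN; rewrite ac ca => /esym/and3P[ks _ sk].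
case/and5P=> _ c0' /eqP eqN' ac' /andP[ca' _].
have := reduced_ineqE s_lo s_hi a0 c0' eqN'.
rewrite ac' ca' => /esym/and3P[ks' _ sk'] kk'.
have k'k : k' = k.
  have subE x y : (x <= y)%N -> (y <= s)%N -> (s < a + x)%N ->
      x = y %[mod a] -> x = y.
    move=> xy ys sx /eqP; rewrite eq_sym eqn_mod_dvd // /dvdn modn_small; lia.
  by case: (leqP k k') => [|/ltnW] /subE E; rewrite E.
rewrite {}k'k in eqN' *; congr (_, _); apply/eqP.
by rewrite -(eqn_pmul2l a0) -(eqn_add2l (k ^ 2)) eqN eqN'.
Qed.

Lemma plus_form_1 : plus_form (1, s, N - s ^ 2)%N.
Proof. by rewrite /plus_form quad_char1 eqxx. Qed.

(** The character vanishes at p, and the last entry is q modulo p. *)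
Lemma plus_form_p : plus_form (p, k_p, q - p * (s %/ p) ^ 2)%N =
  (quad_char p q == -1).
Proof.
rewrite /plus_form (quad_char_dvd p_pr p3 (dvdnn p)) eq_sym oner_eq0 /=.
have [_ c0 _ _ _] := and5P reduced_form_p.
congr (_ == _); apply: quad_char_eq_mod p_pr _ _ _.
move: c0; rewrite subn_gt0; move: ((s %/ p) ^ 2)%N => t ptq.
by rewrite -{2}(subnK (ltnW ptq)) addnC mulnC modnMDl.
Qed.

Lemma card_reduced_forms :
  #|` reduced_forms N| = 2 * (quad_char p q == 1) %[mod 4].
Proof.
set S := reduced_forms N; pose P := [fset f in S | plus_form f]%fset.
have SE f : (f \in S) = reduced_form N f by apply: mem_reduced_forms.
have PE f : (f \in P) = reduced_form N f && plus_form f by rewrite in_sepfset SE.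
clearbody P S.
(* The swap carries [P] bijectively onto its complement in [S]. *)
have cardS : #|` S| = (2 * #|` P|)%N.
  have -> : S = (P `|` swap_form @` P)%fset.
    apply/fsetP => f; rewrite in_fsetU PE SE.
    apply/idP/orP => [Nf|[/andP[]//|/imfsetP[g /=]]]; last first.
      by rewrite PE => /andP[Ng _] ->; apply: reduced_swap.
    have [Pf|Pf] := boolP (plus_form f); [by left; rewrite Nf|right].
    apply/imfsetP; exists (swap_form f); last by rewrite swap_formK.
    by rewrite /= PE reduced_swap // plus_form_swap.
  rewrite cardfsU; have -> : (P `&` swap_form @` P = fset0)%fset.
    apply/fsetP => f; rewrite in_fsetI PE in_fset0; apply/negP.
    case/andP => /andP[Nf Pf] /imfsetP[g /=]; rewrite PE => /andP[Ng Pg] fg.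
    by move: Pf; rewrite fg plus_form_swap // Pg.
  rewrite cardfs0 subn0 (card_imfset _ _ (can_inj swap_formK)) /=.
  by rewrite mulSn mul1n.
have odd_P : odd #|` P| = ~~ (quad_char p q == -1).
  pose f1 := (1, s, N - s ^ 2)%N; pose fp := (p, k_p, q - p * (s %/ p) ^ 2)%N.
  rewrite (@odd_card_involution _ (flip_form N s)); first last.
  - by move=> f; rewrite PE => /andP[Nf _]; apply: flip_formK.
  - move=> f; rewrite !PE => /andP[Nf Pf].
    by rewrite plus_form_flip // Pf andbT; apply: reduced_flip.
  have -> : [fset f in P | flip_form N s f == f]%fset =
      [fset f in [fset f1; fp]%fset | plus_form f]%fset.
    apply/fsetP => f; rewrite !in_sepfset PE in_fset2.
    apply/andP/andP => [[/andP[Nf Pf] /eqP fix_f]|[f_in Pf]]; last first.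
      rewrite Pf andbT; case/orP: f_in => /eqP ->.
        by rewrite reduced_form_1 flip_form_1.
      by rewrite reduced_form_p flip_form_p.
    split=> //; apply/orP; case: f Nf Pf fix_f => [[a k] c] Nf _ fix_f.
    have [a1|ap] := flip_fixed Nf fix_f; [left|right]; apply/eqP.
      rewrite a1 in Nf *; apply: reduced_form_eq reduced_form_1 _ => //.
      by rewrite !modn1.
    rewrite ap in Nf *; apply: reduced_form_eq reduced_form_p _ => //.
    have pk : (p %| k)%N by apply: dvd_p_mid Nf _; rewrite dvdn_mulr.
    by rewrite (eqP pk) modnMr.
  have f1p : f1 != fp by apply/eqP => -[p1]; move: p_pr; rewrite -p1.
  (* [fp] joins [f1] exactly when q has character -1, so the flip has two fixed points in [P] or
     one. *)
  have [qN|qN] := boolP (quad_char p q == -1).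
    rewrite (_ : [fset _ in _ | _]%fset = [fset f1; fp]%fset) ?cardfs2 ?f1p //.
    apply/fsetP => f; rewrite in_sepfset in_fset2 ?in_fset1; apply: andb_idr.
    by case/orP=> /eqP ->; rewrite ?plus_form_1 ?plus_form_p.
  rewrite (_ : [fset _ in _ | _]%fset = [fset f1]%fset) ?cardfs1 //.
  apply/fsetP => f; rewrite in_sepfset in_fset2 ?in_fset1.
  apply/andP/idP => [[/orP[//|/eqP->]]|/eqP->].
    by rewrite plus_form_p (negbTE qN).
  by rewrite eqxx plus_form_1.
have pq' : ~~ (p %| q)%N by rewrite dvdn_prime2 // neq_ltn pq.
have -> : (quad_char p q == 1) = ~~ (quad_char p q == -1).
  have [->|->] := quad_char_pm1 p_pr p3 pq'.
    by rewrite eqxx oner_neqN1_Fp.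
  by rewrite eqxx eq_sym oner_neqN1_Fp.
by rewrite cardS -odd_P; lia.
Qed.

End Count.

(** * Integer square roots, irrationality and conjugates *)

Lemma ex_isqrt (n : nat) : exists s, (s ^ 2 <= n < s.+1 ^ 2)%N.
Proof.
elim: n => [|n [s /andP[sn ns]]]; first by exists 0%N.
have [ns'|sn'] := ltnP n.+1 (s.+1 ^ 2).
  by exists s; rewrite ns' leqW.
by exists s.+1; rewrite sn' /= (leq_ltn_trans ns) // ltn_sqr.
Qed.

(** In n^2 = p q d^2 the exponent of p is even on the left and odd on the right. *)
Lemma sqr_rat_neq_mul_primes (p q : nat) (x : rat) :
  prime p -> prime q -> (p != q)%N -> x ^+ 2 != (p * q)%:R.
Proof.
move=> p_pr q_pr pq; apply/eqP => xN.
have pq0 : (0 < p * q)%N by rewrite muln_gt0 !prime_gt0.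
have d0 : (0 < `|denq x|)%N by rewrite absz_gt0 denq_eq0.
have xE : numq x ^+ 2 = (p * q)%N%:Z * denq x ^+ 2.
  apply: (@intr_inj rat); rewrite !expr2 !intrM numqE -pmulrn -xN.
  by rewrite expr2 mulrACA.
have nE : (`|numq x| ^ 2 = p * q * `|denq x| ^ 2)%N.
  by rewrite -!abszX xE abszM.
have n0 : (0 < `|numq x|)%N.
  by rewrite -(ltn_sqr 0) nE muln_gt0 pq0 expn_gt0 d0.
have := congr1 (logn p) nE.
rewrite -!mulnn !lognM ?muln_gt0 ?n0 ?d0 ?prime_gt0 //.
rewrite (logn_prime p p_pr) eqxx (logn_prime p q_pr) (negbTE pq); lia.
Qed.

(** The irreducible g of the conjugacy either divides f, which then vanishes at w', or is coprime to
    f, which the common root w forbids. *)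
Lemma conjugate_root (R : realType) (w w' : R) (f : {poly rat}) :
  is_conjugate w w' -> root (map_poly ratr f) w -> root (map_poly ratr f) w'.
Proof.
case=> _ [g [g_irr gw gw']] fw.
have [gf|Ngf] := boolP (g %| f).
  by apply: root_dvdp gw'; rewrite dvdp_map.
have : coprimep (map_poly ratr g : {poly R}) (map_poly ratr f).
  by rewrite coprimep_map irreducible_poly_coprime.
by move/coprimep_root => /(_ _ gw); rewrite (rootP fw) eqxx.
Qed.

Lemma horner_map_Poly3 (S S' : nzRingType) (h : {rmorphism S -> S'})
  (a b c : S) (x : S') :
  (map_poly h (Poly [:: c; b; a])).[x] = h a * x ^+ 2 + h b * x + h c.
Proof.
rewrite map_Poly ?rmorph0 // horner_Poly /= mul0r add0r mulrDl -mulrA.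
by rewrite expr2.
Qed.

(** * Bijection between reduced forms and reduced numbers *)

Section Roots.

Variables (R : realType) (N : nat).
Hypothesis N_nsq : forall x : rat, x ^+ 2 != N%:R.

Local Notation sN := (Num.sqrt (N%:R : R)).

Let N0 : 0 < N%:R :> R.
Proof.
rewrite ltr0n lt0n; apply/eqP => N0.
by have := N_nsq 0; rewrite N0 expr0n eqxx.
Qed.

Let sN_gt0 : 0 < sN. Proof. by rewrite sqrtr_gt0. Qed.

Let sN2 : sN ^+ 2 = N%:R. Proof. by rewrite sqr_sqrtr // ltW. Qed.

Let lt_sN (x : R) : x ^+ 2 < N%:R -> x < sN.
Proof.
by move=> xN; rewrite (le_lt_trans (ler_norm x)) // -sqrtr_sqr ltr_sqrt.
Qed.

Let sN_lt (x : R) : 0 <= x -> N%:R < x ^+ 2 -> sN < x.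
Proof.
by move=> x0 Nx; rewrite -(ger0_norm x0) -sqrtr_sqr ltr_sqrt // (lt_trans N0).
Qed.

(** 1 and sqrt N are linearly independent over the rationals: otherwise sqrt N = -u / v, against
    [N_nsq]. *)
Lemma ratr_sqrt_free (u v : rat) : ratr u + ratr v * sN = 0 -> v = 0.
Proof.
move=> uv; apply/eqP; apply/negP => /negP v0.
have v0' : ratr v != 0 :> R by rewrite fmorph_eq0.
have sNE : sN = ratr (- u / v).
  apply: (mulfI v0'); rewrite -rmorphM [v * _]mulrC mulfVK // rmorphN.
  by move/eqP: uv; rewrite addrC addr_eq0 => /eqP.
have /eqP := sN2; rewrite sNE -rmorphXn -(ratr_nat R) /= (inj_eq (fmorph_inj _)).
by rewrite (negbTE (N_nsq _)).
Qed.

Definition form_root (f : nat * nat * nat) : R :=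
  let: (a, k, _) := f in (k%:R + sN) / a%:R.

Lemma form_root_inj : {in reduced_form N &, injective form_root}.
Proof.
case=> [[a k] c] [[a' k'] c'] /and5P[a0 c0 /eqP eqN _ _].
case/and5P=> a0' c0' /eqP eqN' _ _ /= /eqP.
rewrite eqr_div ?pnatr_eq0 -?lt0n // => /eqP ww'.
have aa' : a = a'.
  have : (a'%:R - a%:R : rat) = 0.
    (* Cross-multiplying the equal roots leaves a' k - a k' as rational part and a' - a as
       coefficient of sqrt N. *)
    apply: (@ratr_sqrt_free (a'%:R * k%:R - a%:R * k'%:R)).
    by rewrite !rmorphB !rmorphM /= !ratr_nat; lra.
  by move/eqP; rewrite subr_eq0 eqr_nat => /eqP.
rewrite -{}aa' in eqN' ww' *.
have kk' : k = k'.
  have a_neq0 : a%:R != 0 :> R by rewrite pnatr_eq0 -lt0n.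
  by move/(mulIf a_neq0)/addIr/eqP: ww'; rewrite eqr_nat => /eqP.
rewrite -{}kk' in eqN' *; congr (_, _); apply/eqP.
by rewrite -(eqn_pmul2l a0) -(eqn_add2l (k ^ 2)) eqN eqN'.
Qed.

Lemma form_root_reduced (f : nat * nat * nat) :
  reduced_form N f -> @reduced_quadratic R (4 * N) (form_root f).
Proof.
case: f => [[a k] c] Nf; case/and5P: (Nf) => a0 c0 /eqP eqN ac /andP[ca g1].
have aR : 0 < a%:R :> R by rewrite ltr0n.
have aR0 : a%:R != 0 :> R by rewrite gt_eqF.
set w := form_root _; have aw : a%:R * w = k%:R + sN by rewrite mulrC divfK.
pose w' := (k%:R - sN) / a%:R : R.
have aw' : a%:R * w' = k%:R - sN by rewrite mulrC divfK.
have eqR : k%:R ^+ 2 + a%:R * c%:R = N%:R :> R by rewrite -eqN natrD natrM natrX.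
have w_root : a%:R * w ^+ 2 - (2 * k)%:R * w - c%:R = 0.
  apply: (mulfI aR0); rewrite mulr0 natrM; move: eqR sN2 aw; move: sN => r; nra.
have w'_root : a%:R * w' ^+ 2 - (2 * k)%:R * w' - c%:R = 0.
  apply: (mulfI aR0); rewrite mulr0 natrM; move: eqR sN2 aw'; move: sN => r; nra.
have w_irr : irrational w.
  move=> [x _ xw].
  have : (-1 : rat) = 0.
    (* A rational w = x would give (a x - k) - sqrt N = 0. *)
    apply: (@ratr_sqrt_free (a%:R * x - k%:R)).
    by rewrite rmorphB rmorphM rmorphN1 /= !ratr_nat xw aw; lra.
  by move/eqP; rewrite oppr_eq0 oner_eq0.
split.
- split=> //; exists (Poly [:: - c%:Z; - (2 * k)%N%:Z; a%:Z]); split.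
    by rewrite (@PolyK _ 0) //= eqz_nat -lt0n.
  rewrite /root horner_map_Poly3 /=.
  rewrite !rmorphN /= -!pmulrn mulNr -w_root; exact/eqP.
- have c0R : 0 < c%:R :> R by rewrite ltr0n.
  have k0R : 0 <= k%:R :> R by rewrite ler0n.
  have acR : a%:R < c%:R + 2 * k%:R :> R by rewrite -natrM -natrD ltr_nat.
  have caR : c%:R < a%:R + 2 * k%:R :> R by rewrite -natrM -natrD ltr_nat.
  (* These bounds are compared on squares, with N = k^2 + a c; they use a c > 0, c < a + 2 k and a <
     c + 2 k in turn. *)
  have krs : k%:R < sN by apply: lt_sN; nra.
  have skr : sN < a%:R + k%:R by apply: sN_lt; nra.
  have akr : a%:R - k%:R < sN by apply: lt_sN; nra.
  split; first by rewrite -(ltr_pM2l aR) aw; lra.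
  exists w'; split; last first.
    by apply/andP; split; rewrite -(ltr_pM2l aR) aw'; lra.
  split.
    apply: contraTneq sN_gt0 => ww'; move: aw'; rewrite ww' aw => ?.
    by rewrite -leNgt; lra.
  exists (Poly [:: - c%:R; - (2 * k)%:R; a%:R]); split.
  + apply: cubic_irreducible; first by rewrite (@PolyK _ 0) //= pnatr_eq0 -lt0n.
    move=> x; apply/negP => /rootP; rewrite horner_Poly /= => x_root.
    have /eqP := N_nsq (a%:R * x - k%:R); apply.
    rewrite -eqN natrD natrM natrX; move: x_root; rewrite natrM => x_root.
    have := congr1 ( *%R a%:R) x_root; rewrite mulr0; lra.
  + rewrite /root horner_map_Poly3 !rmorphN /= !ratr_nat mulNr; exact/eqP.
  + rewrite /root horner_map_Poly3 !rmorphN /= !ratr_nat mulNr; exact/eqP.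
- exists a%:Z, (- (2 * k)%N%:Z), (- c%:Z); split.
  + by [].
  + by rewrite /gcdz /= !abszN /= (eqP g1).
  + by rewrite !rmorphN /= -!pmulrn mulNr.
  + by rewrite -eqN; lia.
Qed.

(** By Vieta, b = -a (w + w') and c = a w w'; reducedness then gives the signs of b, of c and of the
    polynomial at 1 and -1. *)
Lemma reduced_quadratic_form (w : R) : @reduced_quadratic R (4 * N) w ->
  exists2 f, reduced_form N f & w = form_root f.
Proof.
move=> [_ [w1 [w' [ww' /andP[w'1 w'0]]]] [a [b [c [a0 g1 wE DE]]]]].
have w'E : a%:~R * w' ^+ 2 + b%:~R * w' + c%:~R = 0 :> R.
  have := @conjugate_root _ _ _ (Poly [:: c%:~R; b%:~R; a%:~R]) ww'.
  rewrite /root !horner_map_Poly3 /= !ratr_int wE eqxx => /(_ isT)/eqP//.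
case: ww' => ww' _.
have aR : 0 < a%:~R :> R by rewrite ltr0z.
(* The difference of the equations for w and w' is divided by w' - w. *)
have bE : b%:~R = - (a%:~R * (w + w')) :> R.
  have w'w : w' - w != 0 by rewrite subr_eq0.
  apply: (mulfI w'w); lra.
have cE : c%:~R = a%:~R * (w * w') :> R.
  by move: wE; rewrite bE; lra.
have b0 : b < 0 by rewrite -(ltrz0 R) bE oppr_lt0 mulr_gt0 //; lra.
have c0 : c < 0 by rewrite -(ltrz0 R) cE pmulr_rlt0 // pmulr_rlt0 //; lra.
have f1 : a + b + c < 0.
  rewrite -(ltrz0 R) !rmorphD /= bE cE.
  have : 0 < (w - 1) * (1 - w') by rewrite mulr_gt0; lra.
  move/(mulr_gt0 aR); lra.
have fN1 : 0 < a - b + c.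
  rewrite -(ltr0z R) rmorphD rmorphB /= bE cE.
  have : 0 < (w + 1) * (1 + w') by rewrite mulr_gt0; lra.
  move/(mulr_gt0 aR); lra.
(* b^2 - 4 a c = 4 N forces b to be even. *)
have [k bk] : exists k : nat, b = - (2 * k)%N%:Z.
  have [e [->|be]] : exists e : nat, b = - (2 * e)%N%:Z \/ b = - (2 * e + 1)%N%:Z.
    by exists `|b|%N./2; lia.
    by exists e.
  by move: DE; rewrite be; lia.
have [m am] : exists m : nat, a = m%:Z by exists `|a|%N; lia.
have [n cn] : exists n : nat, c = - n%:Z by exists `|c|%N; lia.
subst a b c.
have eqN : (k ^ 2 + m * n = N)%N by lia.
exists (m, k, n).
  rewrite /reduced_form eqN eqxx.
  move: g1; rewrite /gcdz !abszN /= => -[->]; rewrite eqxx; lia.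
rewrite /form_root; apply: (mulfI (lt0r_neq0 aR)).
rewrite [RHS]mulrC divfK ?lt0r_neq0 //.
(* m w - k is nonnegative, since 2 k = m (w + w') and w > w', and its square is N. *)
have -> : sN = m%:R * w - k%:R; last by rewrite addrC subrK.
have mk : 0 <= m%:R * w - k%:R.
  move: bE; rewrite rmorphN /= -!pmulrn natrM => bE.
  have : 0 < m%:R * (w - w') by rewrite mulr_gt0 // subr_gt0; lra.
  lra.
rewrite -(ger0_norm mk) -sqrtr_sqr; congr Num.sqrt.
move: wE; rewrite !rmorphN /= -!pmulrn natrM => wE.
by rewrite -eqN natrD natrM natrX; have := congr1 ( *%R m%:R) wE; lra.
Qed.

Lemma kappaE : kappa R (4 * N) = #|` reduced_forms N|.
Proof.
rewrite /kappa.
rewrite (_ : @reduced_quadratic R (4 * N) =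
  (form_root @` [set` reduced_forms N])%classic); last first.
  apply/seteqP; split=> [w /reduced_quadratic_form[f Nf ->]|w [f /= Nf <-]].
    by exists f; rewrite //= mem_reduced_forms.
  by apply: form_root_reduced; rewrite -mem_reduced_forms.
(* The set is an image of a finite set, so the value of [fset_set] on infinite sets does not
   intervene. *)
rewrite fset_set_image; last exact: finite_fset.
rewrite set_fsetK card_in_imfset //= => f g; rewrite !mem_reduced_forms.
exact: form_root_inj.
Qed.

End Roots.

Theorem theorem3p14 (R : realType) (p q : nat) :
  prime p -> prime q -> (p < q)%N ->
  p = 3 %[mod 4] -> q = 3 %[mod 4] ->
  ((kappa R (4 * p * q))%:Z = 1 + legendre q%:Z p %[mod 4])%Z.
Proof.
move=> p_pr q_pr pq p3 q3.
have p_neq_q : (p != q)%N by rewrite neq_ltn pq.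
have pNq : ~~ (p %| q)%N by rewrite dvdn_prime2.
have pq_nsq x := @sqr_rat_neq_mul_primes p q x p_pr q_pr p_neq_q.
have [s /andP[s_lo s_hi]] := ex_isqrt (p * q).
(* Equality would make p q a square. *)
have s_lt : (s ^ 2 < p * q)%N.
  rewrite ltn_neqAle s_lo andbT; apply: contraNneq (pq_nsq s%:R) => <-.
  by rewrite natrX.
rewrite -mulnA (kappaE R pq_nsq) (legendreE p_pr p3 pNq).
have := card_reduced_forms p_pr q_pr pq p3 q3 s_lt s_hi.
(* Character 1 gives 2 = 1 + 1, and character -1 gives 0 = 1 - 1. *)
by case: (quad_char p q == 1); move: #|`_| => n; lia.
Qed.
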